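(* Let $i,j,s,t,u,v\in\mathbb{Z}$ with $i+j$, $s+t$, $u+v$ all positive. Suppose that for all complex $q$ with $|q|<1$, $$f(q^i,q^j)f(q^s,q^t)f(q^u,q^v)=\sum_{r=1}^k m_r\,q^{r-1}f(q^{ka_{1r}},q^{ka_{2r}})\,f(q^{kb_{1r}},q^{kb_{2r}})\,f(q^{kc_{1r}},q^{kc_{2r}}),$$ where $a_{1r},a_{2r},b_{1r},b_{2r},c_{1r},c_{2r}\in\mathbb{Z}$ and $k,\ m_r,\ a_{1r}+a_{2r},\ b_{1r}+b_{2r},\ c_{1r}+c_{2r}$ are positive integers (for $r=1,\dots,k$). (i) The tuple $(i+j,\,i-j,\,s+t,\,s-t,\,u+v,\,u-v)$ is universal if and only if the tuple $(a_{1r}+a_{2r},\,a_{1r}-a_{2r},\,b_{1r}+b_{2r},\,b_{1r}-b_{2r},\,c_{1r}+c_{2r},\,c_{1r}-c_{2r})$ is universal for every $r=1,\ldots,k$. (ii) The tuple $(i+j,\,i-j,\,s+t,\,s-t,\,u+v,\,u-v)$ is almost universal if and only if the tuple $(a_{1r}+a_{2r},\,a_{1r}-a_{2r},\,b_{1r}+b_{2r},\,b_{1r}-b_{2r},\,c_{1r}+c_{2r},\,c_{1r}-c_{2r})$ is almost universal for every $r=1,\ldots,k$.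
   Context: Ramanujan's general theta function is $f(a,b)=\sum_{n=-\infty}^{\infty}a^{n(n+1)/2}b^{n(n-1)/2}$ for $|ab|<1$; thus for integers $a,b$ with $a+b>0$ and $|q|<1$, $f(q^a,q^b)=\sum_{x\in\mathbb{Z}}q^{x((a+b)x+a-b)/2}$. For $a_1,b_1,c_1$ positive integers and $a_2,b_2,c_2$ integers with $a_1-a_2$, $b_1-b_2$, $c_1-c_2$ all even, the tuple $(a_1,a_2,b_1,b_2,c_1,c_2)$ is called universal if every nonnegative integer $n$ can be written as $\frac{x(a_1x+a_2)}2+\frac{y(b_1y+b_2)}2+\frac{z(c_1z+c_2)}2$ with $x,y,z\in\mathbb{Z}$, and almost universal if all but finitely many nonnegative integers can be so written. *)

(* Defs.v *)
From HB Require Import structures.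
From mathcomp Require Import all_boot all_order all_algebra.
From mathcomp Require Import all_classical all_reals all_analysis.
From mathcomp Require Import complex.

Set Implicit Arguments.
Unset Strict Implicit.
Unset Printing Implicit Defensive.

Import Order.TTheory GRing.Theory Num.Theory.
Import numFieldNormedType.Exports.

Local Open Scope classical_set_scope.
Local Open Scope ring_scope.

Section Theta.
Variable R : realType.
Implicit Types (a b : R[i]) (n : int).

(* For every n : int both n (n + 1) and n (n - 1) are even and nonnegative, so
   the divisions are exact and the exponents are natural numbers (in
   particular, 0 ^ 0 = 1 is the only convention involved when a or b is 0). *)
Definition theta_term a b n : R[i] :=
  a ^ (n * (n + 1) %/ 2)%Z * b ^ (n * (n - 1) %/ 2)%Z.

(* Ramanujan's f(a, b).  The sum over all integers is the sum of the series over
   n >= 0 and of the series over n < 0; both converge absolutely when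
   `|a * b| < 1, and the value is meaningless otherwise.  The topology is carried
   by the regular module R[i]^o. *)
Definition theta a b : R[i] :=
  limn (series (fun n : nat => theta_term a b n%:Z) : nat -> R[i]^o) +
  limn (series (fun n : nat => theta_term a b (- n.+1%:Z)) : nat -> R[i]^o).

End Theta.

(* The usual conventions a1, b1, c1 > 0 and a1 = a2, b1 = b2, c1 = c2 mod 2 (which
   make each summand an integer) are left to the users of these predicates. *)
Definition represented (a1 a2 b1 b2 c1 c2 : int) (n : nat) : Prop :=
  exists x y z : int,
    n%:R = (x * (a1 * x + a2))%:~R / 2 + (y * (b1 * y + b2))%:~R / 2
           + (z * (c1 * z + c2))%:~R / 2 :> rat.

Definition universal (a1 a2 b1 b2 c1 c2 : int) : Prop :=
  forall n : nat, represented a1 a2 b1 b2 c1 c2 n.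

Definition almost_universal (a1 a2 b1 b2 c1 c2 : int) : Prop :=
  finite_set [set n : nat | ~ represented a1 a2 b1 b2 c1 c2 n].

(* Main.v *)
(* Restrict the identity to real q in (0, 1): every series then has nonnegative
   terms, and both sides are Laurent series in q with natural number
   coefficients, the coefficient of q^n on the left being the number of
   representations of n by the sum of the three forms attached to (i, j),
   (s, t), (u, v).  By uniqueness of Laurent coefficients, the exponents that
   occur are the same on both sides.  Since 0 <= r - 1 < k, the exponents
   congruent to r - 1 modulo k on the right come from the r-th summand alone, so
   k n + r - 1 is represented by the left-hand form if and only if n is
   represented by the r-th form; both equivalences follow by dividing by k. *)
Require Import Defs.
From HB Require Import structures.
From mathcomp Require Import all_boot all_order all_algebra.
From mathcomp Require Import all_classical all_reals all_analysis.
From mathcomp Require Import complex.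
From mathcomp Require Import zify ring lra.

Set Implicit Arguments.
Unset Strict Implicit.
Unset Printing Implicit Defensive.

Import Order.TTheory GRing.Theory Num.Theory.
Import numFieldNormedType.Exports.

Local Open Scope ring_scope.

(** * Multisets of exponents and uniqueness of Laurent coefficients *)

Lemma perm_eq_filter_le_succ (s s' : seq int) (n : int) :
  perm_eq [seq e <- s | e <= n] [seq e <- s' | e <= n] ->
  count_mem (n + 1) s = count_mem (n + 1) s' ->
  perm_eq [seq e <- s | e <= n + 1] [seq e <- s' | e <= n + 1].
Proof.
move=> /permP pn cn; apply/allP => e _; apply/eqP; rewrite !count_filter.
have [le_en | lt_ne] := leP e n.
  have E : predI (pred1 e) (fun d => d <= n + 1) =1 predI (pred1 e) (fun d => d <= n).
    by move=> d /=; case: eqP => //= ->; rewrite le_en; apply/idP; lia.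
  by rewrite !(eq_count E) -!count_filter.
have [-> | ne_en] := eqVneq e (n + 1).
  have E : predI (pred1 (n + 1)) (fun d => d <= n + 1) =1 pred1 (n + 1).
    by move=> d /=; case: eqP => //= ->; rewrite lexx.
  by rewrite !(eq_count E).
have E : predI (pred1 e) (fun d => d <= n + 1) =1 pred0.
  by move=> d /=; case: eqP => //= ->; lia.
by rewrite !(eq_count E) !count_pred0.
Qed.

Section Enumeration.
Local Open Scope classical_set_scope.
Local Open Scope ring_scope.
Variable R : realType.
Implicit Types (F G : R -> R) (x : R) (e n : int).

Lemma ler_expz_lt1 x e n : 0 < x < 1 -> (x ^ n <= x ^ e) = (e <= n).
Proof.
move=> /andP[x_gt0 x_lt1].
have expN (d : int) : x ^ d = x^-1 ^ (- d) by rewrite exprz_inv opprK.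
by rewrite !expN ler_eXz2l ?invf_gt1 // lerN2.
Qed.

(* [F x] is the sum of [x ^ e] over the multiset of exponents exhausted by the
   finite multisets [s N]. *)
Definition enumerates (s : nat -> seq int) F : Prop :=
  {homo s : N N' / (N <= N')%N >-> {subset N <= N'}} /\
  forall x, 0 < x < 1 -> (fun N => \sum_(e <- s N) x ^ e) @ \oo --> F x.

Definition support (s : nat -> seq int) e : Prop := exists N, e \in s N.

Lemma enumerates_eq s F G :
  (forall x, 0 < x < 1 -> F x = G x) -> enumerates s F -> enumerates s G.
Proof. by move=> FG [sub cvF]; split=> // x x01; rewrite -FG //; apply: cvF. Qed.

(** Convergence at the reference point [2^-1] gives the bound. It is only eventual: the inclusions
    between the [s N] control membership but not multiplicity, so the sums need not increase with
    [N]. *)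
Lemma enumerates_bounded s F : enumerates s F ->
  exists2 B : R, 0 < B & \forall N \near \oo, \sum_(e <- s N) (2^-1 : R) ^ e <= B.
Proof.
move=> [_ cvF]; have h01 : 0 < (2^-1 : R) < 1 by apply/andP; split; lra.
exists (`|F 2^-1| + 1); first by rewrite ltr_wpDl.
have /cvgrPdist_lt /(_ _ ltr01) := cvF _ h01; apply: filterS => N.
by rewrite distrC ltr_distl => /andP[_ /ltW /le_trans -> //]; rewrite lerD2r ler_norm.
Qed.

(** All terms are nonnegative, so a single very negative exponent would already push the sum at
    [2^-1] above its bound. *)
Lemma enumerates_lower_bound s F : enumerates s F ->
  exists D : int, \forall N \near \oo, forall e, e <= D -> e \notin s N.
Proof.
move=> /enumerates_bounded[B B_gt0 nearB].
have h01 : 0 < (2^-1 : R) < 1 by apply/andP; split; lra.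
(* With this choice [B < d < 2 ^ d], and [2 ^ d] is the value of [2^-1 ^ (- d)]. *)
pose d := (Num.truncn B).+1.
exists (- d%:Z); apply: filterS nearB => N leB e le_ed.
apply/negP => e_in; move: leB; apply/negP; rewrite -ltNge.
apply: (@lt_le_trans _ _ (2^-1 ^ e)); last first.
  rewrite (perm_big _ (perm_to_rem e_in)) big_cons lerDl sumr_ge0 // => n _.
  by rewrite exprz_ge0 // invr_ge0.
apply: (@lt_le_trans _ _ (2^-1 ^ (- d%:Z))); last by rewrite ler_expz_lt1.
rewrite exprz_inv opprK; apply: lt_trans (truncnS_gt B) _.
by rewrite -exprnP -natrX ltr_nat ltn_expl.
Qed.

(** Write [x ^ e = (2 * x) ^ e * 2^-1 ^ e]. Since [2 * x <= 1], the first factor is at most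
    [(2 * x) ^ (n + 1)] for [e > n], and the second factors sum to at most [B]. *)
Lemma sum_tail_le (s : seq int) x n B : 0 < x <= 2^-1 ->
  \sum_(e <- s) (2^-1 : R) ^ e <= B ->
  0 <= \sum_(e <- s | ~~ (e <= n)) x ^ e <= (2 * x) ^ (n + 1) * B.
Proof.
move=> /andP[x_gt0 x_le] leB; apply/andP; split.
  by apply: sumr_ge0 => e _; rewrite exprz_ge0 // ltW.
have x2_gt0 : 0 < 2 * x by lra.
apply: le_trans (_ : (2 * x) ^ (n + 1) * \sum_(e <- s) 2^-1 ^ e <= _); last first.
  by rewrite ler_wpM2l // exprz_ge0 // ltW.
rewrite mulr_sumr big_mkcond /=; apply: ler_sum => e _.
case: ifP => [lt_ne | _]; last first.
  by rewrite mulr_ge0 // exprz_ge0 // ?invr_ge0 // ltW.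
have -> : x ^ e = (2 * x) ^ e * 2^-1 ^ e.
  by rewrite -expfzMl; congr (_ ^ _); field.
rewrite ler_wpM2r ?exprz_ge0 ?invr_ge0 //.
have [lt1 | ge1] := ltP (2 * x) 1.
  by rewrite ler_expz_lt1 ?x2_gt0 //; lia.
have -> : 2 * x = 1 by lra.
by rewrite !exp1rz.
Qed.

Lemma sum_filter_succ (s : seq int) x n : x != 0 ->
  \sum_(e <- s) x ^ e =
  \sum_(e <- [seq e <- s | e <= n]) x ^ e
  + ((count_mem (n + 1) s)%:R * x ^ (n + 1)
     + \sum_(e <- s | ~~ (e <= n + 1)) x ^ e).
Proof.
move=> x0; rewrite (bigID (fun d => d <= n)) /= big_filter; congr (_ + _).
rewrite (bigID (pred1 (n + 1))) /=; congr (_ + _); last first.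
  by apply: eq_bigl => e; apply/idP/idP; lia.
rewrite -sum1_count natr_sum mulr_suml.
apply: eq_big => [e | e /andP[_ /eqP ->]] /=; last by rewrite mul1r.
by apply/idP/idP; lia.
Qed.

(** Triangle inequality for two expansions of the same value [f]: [a] is the common part of low
    degree, [p] and [p'] are the terms to compare, [t] and [t'] the tails. *)
Lemma sub_lt_of_close (f a p p' t t' T T' y : R) :
  0 <= t <= T -> 0 <= t' <= T' ->
  `|f - (a + (p + t))| < y / 4 -> `|f - (a + (p' + t'))| < y / 4 ->
  T + T' < y / 2 -> `|p - p'| < y.
Proof.
move=> /andP[? ?] /andP[? ?]; rewrite !ltr_norml => /andP[? ?] /andP[? ?] ?.
by apply/andP; split; lra.
Qed.

(* Uniqueness of the coefficients of a Laurent series at the origin: once the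
   terms of degree at most [n] agree, letting [x] be small enough makes the
   terms of degree greater than [n + 1] negligible before [x ^ (n + 1)]. *)
Lemma enumerates_perm_succ s s' F n : enumerates s F -> enumerates s' F ->
  (\forall N \near \oo,
     perm_eq [seq e <- s N | e <= n] [seq e <- s' N | e <= n]) ->
  \forall N \near \oo,
     perm_eq [seq e <- s N | e <= n + 1] [seq e <- s' N | e <= n + 1].
Proof.
have nat_eq (p p' : nat) : `|p%:Z - p'%:Z| < 1 -> p = p' by lia.
move=> sF s'F pn.
have [B B_gt0 nearB] := enumerates_bounded sF.
have [B' B'_gt0 nearB'] := enumerates_bounded s'F.
(* The two tails beyond degree [n + 1] add up to at most [K * x * x ^ (n + 1)]. The choice of [x]
   below makes [K * x < 1/2], and the summand [2] in its denominator ensures [x <= 1/2]. *)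
pose K := 2 ^ (n + 1 + 1) * (B + B') : R.
have K_gt0 : 0 < K by rewrite mulr_gt0 ?exprz_gt0 ?addr_gt0.
pose x : R := (2 * K + 2)^-1.
have x_gt0 : 0 < x by rewrite invr_gt0; lra.
have x0 : x != 0 by rewrite gt_eqF.
have x_le : x <= 2^-1 by rewrite lef_pV2 ?posrE; lra.
have Kx : K * x < 2^-1.
  by rewrite ltr_pdivrMr; lra.
have x01 : 0 < x < 1 by apply/andP; split; lra.
have xn_gt0 : 0 < x ^ (n + 1) by rewrite exprz_gt0.
have eps_gt0 : 0 < x ^ (n + 1) / 4 by rewrite divr_gt0.
have /cvgrPdist_lt /(_ _ eps_gt0) cs := sF.2 _ x01.
have /cvgrPdist_lt /(_ _ eps_gt0) cs' := s'F.2 _ x01.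
near=> N.
have pN : perm_eq [seq e <- s N | e <= n] [seq e <- s' N | e <= n] by near: N.
have leB : \sum_(e <- s N) (2^-1 : R) ^ e <= B by near: N.
have leB' : \sum_(e <- s' N) (2^-1 : R) ^ e <= B' by near: N.
apply: perm_eq_filter_le_succ => //.
have closeN : `|F x - \sum_(e <- s N) x ^ e| < x ^ (n + 1) / 4 by near: N.
have closeN' : `|F x - \sum_(e <- s' N) x ^ e| < x ^ (n + 1) / 4 by near: N.
have x02 : 0 < x <= 2^-1 by rewrite x_gt0.
have tB := sum_tail_le (n + 1) x02 leB.
have tB' := sum_tail_le (n + 1) x02 leB'.
have EK : (2 * x) ^ (n + 1 + 1) * (B + B') = K * x * x ^ (n + 1).
  by rewrite /K expfzMl (expfzDr (n + 1) 1 x0) expr1z; ring.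
have ltK : (2 * x) ^ (n + 1 + 1) * (B + B') < x ^ (n + 1) / 2.
  by rewrite EK mulrC ltr_pM2l.
rewrite mulrDr in ltK.
rewrite (sum_filter_succ (s N) n x0) in closeN.
rewrite (sum_filter_succ (s' N) n x0) -(perm_big _ pN) in closeN'.
have := sub_lt_of_close tB tB' closeN closeN' ltK.
(* After division by [x ^ (n + 1)], the two multiplicities of [n + 1] are natural numbers at
   distance less than 1, hence equal. *)
rewrite -mulrBl normrM (gtr0_norm xn_gt0) -[ltRHS]mul1r.
set c := count_mem _ _; set c' := count_mem _ _.
rewrite ltr_pM2r // -[c%:R]/(c%:Z%:~R) -[c'%:R]/(c'%:Z%:~R) -intrB.
by rewrite -intr_norm ltrz1 => /nat_eq.
Unshelve. all: by end_near.
Qed.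

(** Induction on the truncation degree, starting at [d], below which both multisets are eventually
    empty. Every [e] is reached after finitely many steps. *)
Lemma enumerates_unique s s' F : enumerates s F -> enumerates s' F ->
  forall e, support s e <-> support s' e.
Proof.
move=> sF s'F.
have [D nearD] := enumerates_lower_bound sF.
have [D' nearD'] := enumerates_lower_bound s'F.
pose d := Num.min D D'.
have perm_le (p : nat) : \forall N \near \oo,
    perm_eq [seq e <- s N | e <= d + p%:Z] [seq e <- s' N | e <= d + p%:Z].
  elim: p => [|p IHp].
    near=> N.
    have low : forall e, e <= D -> e \notin s N by near: N.
    have low' : forall e, e <= D' -> e \notin s' N by near: N.
    have E (r : seq int) (C : int) : d <= C -> (forall e, e <= C -> e \notin r) ->
        [seq e <- r | e <= d + 0%:Z] = [::].
      move=> le_dC rC; apply/eqP; rewrite -[_ == _]negbK -has_filter.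
      apply/hasPn => e e_r; apply/negP => le_ed.
      by move: (rC e); rewrite e_r => /(_ _)/implyP; lia.
    rewrite (E _ D) ?(E _ D') //; rewrite /d; lia.
  have -> : d + p.+1%:Z = d + p%:Z + 1 by lia.
  exact: enumerates_perm_succ sF s'F IHp.
(* An exponent that occurs once stays in all later multisets, so it is still present at an index
   where both memberships agree. *)
have near_supp (r r' : nat -> seq int) e :
    enumerates r F -> (\forall N \near \oo, (e \in r N) = (e \in r' N)) ->
    support r e -> support r' e.
  move=> [sub _] [M _ rM] [N e_rN]; exists (maxn M N).
  by rewrite -rM /= ?leq_maxl //; apply: sub e_rN; rewrite leq_maxr.
move=> e.
have eq_in : \forall N \near \oo, (e \in s N) = (e \in s' N).
  have := perm_le `|e - d|%N; apply: filterS => N /perm_mem /(_ e).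
  by rewrite !mem_filter (_ : e <= _)//; lia.
split; first exact: near_supp sF eq_in.
by apply: near_supp s'F _; apply: filterS eq_in.
Unshelve. all: by end_near.
Qed.

(** * Constants, products and sums of enumerated series *)

Lemma enumerates_cst e : enumerates (fun=> [:: e]) (fun x => x ^ e).
Proof.
split=> [N N' _ d // | x _]; rewrite big_seq1; exact: cvg_cst.
Qed.

(** A natural coefficient is the exponent [0] with multiplicity [p]; the [m_r] thus become ordinary
    factors. *)
Lemma enumerates_nseq p : enumerates (fun=> nseq p 0) (fun=> p%:R).
Proof.
split=> [N N' _ d // | x _]; rewrite big_nseq iter_addr_0 expr0z; exact: cvg_cst.
Qed.

Definition mul_exps (s s' : nat -> seq int) (N : nat) : seq int :=
  [seq e + e' | e <- s N, e' <- s' N].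

Lemma enumerates_mul s s' F G : enumerates s F -> enumerates s' G ->
  enumerates (mul_exps s s') (fun x => F x * G x).
Proof.
move=> [sub cvF] [sub' cvG]; split=> [N N' leN e | x x01].
  move=> /allpairsP[[a b] /= [ha hb ->]].
  by apply: allpairs_f; [apply: sub leN _ ha | apply: sub' leN _ hb].
have x0 : x != 0 by case/andP: x01 => /gt_eqF ->.
apply: cvg_trans (cvgM (cvF _ x01) (cvG _ x01)).
apply: near_eq_cvg; apply: nearW => N /=.
rewrite /mul_exps big_allpairs_dep /= mulr_suml; apply: eq_bigr => e _.
by rewrite mulr_sumr; apply: eq_bigr => e' _; rewrite expfzDr.
Qed.

(** Monotonicity in [N] brings the two exponents, found at different indices, to a common index. *)
Lemma support_mul s s' F G e : enumerates s F -> enumerates s' G ->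
  support (mul_exps s s') e <->
  exists a b, [/\ support s a, support s' b & e = a + b].
Proof.
move=> [sub _] [sub' _]; split=> [[N /allpairsP[[a b] /= [ha hb ->]]] |].
  by exists a, b; split=> //; exists N.
move=> [a [b [[N ha] [N' hb] ->]]]; exists (maxn N N').
apply: allpairs_f; [apply: sub ha | apply: sub' hb].
  exact: leq_maxl.
exact: leq_maxr.
Qed.

Lemma enumerates_sum (rs : seq nat) (s : nat -> nat -> seq int)
    (F : nat -> R -> R) :
  (forall r, r \in rs -> enumerates (s r) (F r)) ->
  enumerates (fun N => flatten [seq s r N | r <- rs])
    (fun x => \sum_(r <- rs) F r x).
Proof.
move=> sF; split=> [N N' leN e | x x01].
  move=> /flatten_mapP[r r_in e_in]; apply/flatten_mapP; exists r => //.
  exact: (sF r r_in).1 leN _ e_in.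
under eq_fun do rewrite big_flatten big_map big_seq.
rewrite big_seq; apply: cvg_big => [|r /sF[_]]; last exact.
exact: add_continuous.
Qed.

Lemma support_sum (rs : seq nat) (s : nat -> nat -> seq int) e :
  support (fun N => flatten [seq s r N | r <- rs]) e <->
  exists2 r, r \in rs & support (s r) e.
Proof.
split=> [[N /flatten_mapP[r r_in e_in]] | [r r_in [N e_in]]].
  by exists r => //; exists N.
by exists N; apply/flatten_mapP; exists r.
Qed.

End Enumeration.

(** * Theta series at real arguments, as enumerations of exponents *)

Section ThetaExponents.
Variable R : realType.
Implicit Types (x : R) (i j n : int).

Definition theta_exp i j n : int :=
  i * (n * (n + 1) %/ 2)%Z + j * (n * (n - 1) %/ 2)%Z.

(** A product of two consecutive integers is even, so both divisions are exact. This identifies the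
    theta exponents with the values of the quadratic forms. *)
Lemma double_theta_exp i j n : theta_exp i j n * 2 = n * ((i + j) * n + (i - j)).
Proof.
have ev m : (m * (m + 1) %/ 2)%Z * 2 = m * (m + 1).
  apply: divzK; have [] : (m %% 2 = 0)%Z \/ (m %% 2 = 1)%Z by lia.
    by move=> m2; apply: dvdz_mulr; apply/dvdz_mod0P.
  by move=> m2; apply: dvdz_mull; apply/dvdz_mod0P; lia.
have ev' : (n * (n - 1) %/ 2)%Z * 2 = n * (n - 1).
  by have := ev (n - 1); rewrite subrK [(n - 1) * n]mulrC.
by rewrite /theta_exp mulrDl -!mulrA ev ev'; ring.
Qed.

Lemma theta_exp_scale (k : int) i j n :
  theta_exp (k * i) (k * j) n = k * theta_exp i j n.
Proof. by rewrite /theta_exp; ring. Qed.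

(** With [a = |n|] and [d = |i - j|], twice the exponent is at least [a^2 - a d], and
    [a^2 - a (d + 2) + 2 (d + 2)^2] is never negative. A bound linear in [|n|] is what comparison
    with a geometric series needs. *)
Lemma theta_exp_ge i j n : 0 < i + j ->
  `|n| - (`|i - j| + 2) ^+ 2 <= theta_exp i j n.
Proof.
move=> ij_gt0; have := double_theta_exp i j n; set e := theta_exp _ _ _ => E.
have nn : n * n = `|n| * `|n| by rewrite -normrM ger0_norm // -expr2 sqr_ge0.
have h1 : `|n| * `|n| <= (i + j) * (n * n) by rewrite nn; nia.
have h2 : - (`|n| * `|i - j|) <= n * (i - j).
  by rewrite -normrM lerNl; apply: le_trans (ler_norm _) _; rewrite normrN.
have n0 : 0 <= `|n| by []; have d0 : 0 <= `|i - j| by [].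
move: `|n| `|i - j| n0 d0 h1 h2 => a d a0 d0 h1 h2.
rewrite expr2; nia.
Qed.

(** Each step adds one index [n >= 0] and one index [n < 0], in parallel with the two half-series
    that define [theta]. *)
Fixpoint int_box (N : nat) : seq int :=
  if N is N'.+1 then [:: N'%:Z, - N'.+1%:Z & int_box N'] else [::].

Lemma mem_int_box N n : (n \in int_box N) = (- N%:Z <= n < N%:Z).
Proof.
elim: N => [|N IHN]; first by rewrite in_nil; lia.
by rewrite !inE IHN; lia.
Qed.

Definition theta_exps i j (N : nat) : seq int :=
  [seq theta_exp i j n | n <- int_box N].

Lemma support_theta_exps i j e :
  support (theta_exps i j) e <-> exists n, e = theta_exp i j n.
Proof.
split=> [[N /mapP[n _ ->]] | [n ->]]; first by exists n.
by exists `|n|.+1; apply: map_f; rewrite mem_int_box; lia.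
Qed.

Lemma sum_theta_exps i j x N :
  \sum_(e <- theta_exps i j N) x ^ e =
  series (fun n : nat => x ^ theta_exp i j n%:Z) N
  + series (fun n : nat => x ^ theta_exp i j (- n.+1%:Z)) N.
Proof.
elim: N => [|N IHN]; first by rewrite /series /= !big_geq // big_nil addr0.
rewrite !seriesS -[X in _ = X + _]addrC /=.
rewrite /theta_exps /= !big_cons -/(theta_exps i j N) IHN; ring.
Qed.

Lemma is_cvg_series_expz (f : nat -> int) (C : int) x : 0 < x < 1 ->
  (forall n : nat, n%:Z - C <= f n) -> cvgn (series (fun n : nat => x ^ f n)).
Proof.
move=> x01 le_f; have /andP[x_gt0 x_lt1] := x01.
apply: (@series_le_cvg _ _ (geometric (x ^ (- C)) x)) => [n|n|n|].
- by rewrite exprz_ge0 // ltW.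
- by rewrite /= mulr_ge0 ?exprn_ge0 ?exprz_ge0 // ltW.
- rewrite /= exprnP -expfzDr ?gt_eqF // ler_expz_lt1 //.
  by rewrite addrC.
- by apply: is_cvg_geometric_series; rewrite gtr0_norm.
Qed.

Lemma cvg_real_complex (u : nat -> R) (l : R) : (u @ \oo --> l)%classic ->
  ((fun n : nat => (u n)%:C%C : R[i]^o) @ \oo --> (l%:C%C : R[i]^o))%classic.
Proof.
move=> /cvgrPdist_lt ul; apply/cvgrPdist_lt => eps eps_gt0.
(* In the order of [R[i]] a positive element is real, so [eps] is also a tolerance in [R]. *)
have eps_real : (complex.Re eps)%:C%C = eps by rewrite RRe_real // gtr0_real.
move: eps_gt0; rewrite -eps_real ltcR => /ul; apply: filterS => n.
rewrite -(rmorphB (real_complex R)) normc_def /= expr0n addr0 sqrtr_sqr.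
by rewrite ltcR.
Qed.

Lemma lim_series_real_complex (u : nat -> R) : cvgn (series u) ->
  (limn (series (fun n : nat => (u n)%:C%C) : nat -> R[i]^o))%classic =
  (limn (series u))%:C%C.
Proof.
move=> /cvg_real_complex cu; apply: cvg_lim; first exact: norm_hausdorff.
by apply: cvg_trans cu; apply: near_eq_cvg; apply: nearW => n; rewrite rmorph_sum.
Qed.

Lemma theta_termE (q : R[i]) i j n : q != 0 ->
  theta_term (q ^ i) (q ^ j) n = q ^ theta_exp i j n.
Proof. by move=> q0; rewrite /theta_term !exprz_exp -expfzDr. Qed.

Definition real_theta i j x : R :=
  limn (series (fun n : nat => x ^ theta_exp i j n%:Z))
  + limn (series (fun n : nat => x ^ theta_exp i j (- n.+1%:Z))).

Lemma is_cvg_series_theta_exp i j x : 0 < i + j -> 0 < x < 1 ->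
  cvgn (series (fun n : nat => x ^ theta_exp i j n%:Z)) /\
  cvgn (series (fun n : nat => x ^ theta_exp i j (- n.+1%:Z))).
Proof.
move=> ij_gt0 x01.
split; apply: (@is_cvg_series_expz _ ((`|i - j| + 2) ^+ 2)) => // n.
  exact: (theta_exp_ge n%:Z ij_gt0).
apply: le_trans (theta_exp_ge (- n.+1%:Z) ij_gt0).
by rewrite lerD2r; lia.
Qed.

Lemma enumerates_theta i j : 0 < i + j ->
  enumerates (theta_exps i j) (real_theta i j).
Proof.
move=> ij_gt0; split=> [N N' leN e /mapP[n n_in ->] | x x01].
  by apply: map_f; move: n_in; rewrite !mem_int_box; lia.
have [cvp cvn] := is_cvg_series_theta_exp ij_gt0 x01.
by under eq_fun do rewrite sum_theta_exps; apply: cvgD.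
Qed.

Lemma theta_real_complex i j x : 0 < i + j -> 0 < x < 1 ->
  theta (x%:C%C ^ i) (x%:C%C ^ j) = (real_theta i j x)%:C%C.
Proof.
move=> ij_gt0 x01; have [cvp cvn] := is_cvg_series_theta_exp ij_gt0 x01.
have x0 : x%:C%C != 0 :> R[i].
  by rewrite (inj_eq (@complexI R) x 0) gt_eqF //; case/andP: x01.
have termE (f : nat -> int) : (fun k => theta_term (x%:C%C ^ i) (x%:C%C ^ j) (f k)) =
    (fun k => (x ^ theta_exp i j (f k))%:C%C).
  by apply/funext => k; rewrite theta_termE // (fmorphXz (real_complex R)).
by rewrite /theta !termE !lim_series_real_complex // -rmorphD.
Qed.

End ThetaExponents.

(** * Sums of three theta exponents and products of three theta series *)

Definition sum3_theta_exp (i j s t u v n : int) : Prop :=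
  exists x y z : int, n = theta_exp i j x + theta_exp s t y + theta_exp u v z.

Lemma representedE (i j s t u v : int) (n : nat) :
  represented (i + j) (i - j) (s + t) (s - t) (u + v) (u - v) n <->
  sum3_theta_exp i j s t u v n%:Z.
Proof.
have half (a b x : int) :
    (x * ((a + b) * x + (a - b)))%:~R / 2 = (theta_exp a b x)%:~R :> rat.
  by rewrite -double_theta_exp intrM mulfK.
split=> [] [x [y [z E]]]; exists x, y, z; last first.
  by rewrite !half -!intrD -E.
by apply: (@intr_inj rat); rewrite -[_%:~R]/(n%:R) E !half -!intrD.
Qed.

Section Product.
Variable R : realType.
Implicit Types (F : R -> R) (i j e : int) (ss : nat -> seq int).

Lemma support_mul_theta ss F i j e : enumerates ss F -> 0 < i + j ->
  support (mul_exps ss (theta_exps i j)) e <->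
  exists2 d, support ss d & exists x, e = d + theta_exp i j x.
Proof.
move=> sF ij_gt0; split.
  move=> /(support_mul _ sF (enumerates_theta R ij_gt0))[a [b [ha /support_theta_exps[x ->] ->]]].
  by exists a => //; exists x.
move=> [d sd [x ->]]; apply/(support_mul _ sF (enumerates_theta R ij_gt0)).
by exists d, (theta_exp i j x); split=> //; apply/support_theta_exps; exists x.
Qed.

(** The factor [ss] stands for the coefficient in front of the product, so that the same lemma
    serves both sides of the identity. *)
Lemma support_theta_product ss F (i j s t u v e : int) : enumerates ss F ->
  0 < i + j -> 0 < s + t -> 0 < u + v ->
  support (mul_exps (mul_exps (mul_exps ss (theta_exps i j)) (theta_exps s t))
             (theta_exps u v)) e <->
  exists2 d, support ss d &
    exists2 n, sum3_theta_exp i j s t u v n & e = d + n.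
Proof.
move=> sF ij_gt0 st_gt0 uv_gt0.
have sF1 := enumerates_mul sF (enumerates_theta R ij_gt0).
have sF2 := enumerates_mul sF1 (enumerates_theta R st_gt0).
rewrite (support_mul_theta _ sF2) //; split.
  move=> [a /(support_mul_theta _ sF1 st_gt0)[b /(support_mul_theta _ sF ij_gt0)]].
  move=> [d sd [x ->]] [y ->] [z ->]; exists d => //.
  by exists (theta_exp i j x + theta_exp s t y + theta_exp u v z);
    [exists x, y, z | rewrite !addrA].
move=> [d sd [_ [x [y [z ->]]] ->]].
exists (d + theta_exp i j x + theta_exp s t y); last by exists z; rewrite !addrA.
apply/(support_mul_theta _ sF1 st_gt0); exists (d + theta_exp i j x); last by exists y.
by apply/(support_mul_theta _ sF ij_gt0); exists d => //; exists x.
Qed.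

Lemma enumerates_theta_product ss F (i j s t u v : int) : enumerates ss F ->
  0 < i + j -> 0 < s + t -> 0 < u + v ->
  enumerates (mul_exps (mul_exps (mul_exps ss (theta_exps i j)) (theta_exps s t))
                (theta_exps u v))
    (fun x => F x * real_theta i j x * real_theta s t x * real_theta u v x).
Proof. by do 3!(move=> /enumerates_mul + /(enumerates_theta R) => /[apply]). Qed.

End Product.

(** * From the identity of functions to the represented integers *)

Lemma theta_identity_support (R : realType) (i j s t u v : int)
    (k : nat) (m : nat -> nat) (a1 a2 b1 b2 c1 c2 : nat -> int)
    (ij_gt0 : 0 < i + j) (st_gt0 : 0 < s + t) (uv_gt0 : 0 < u + v)
    (k_gt0 : (0 < k)%N)
    (m_gt0 : forall r : nat, (1 <= r <= k)%N -> (0 < m r)%N)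
    (a_gt0 : forall r : nat, (1 <= r <= k)%N -> 0 < a1 r + a2 r)
    (b_gt0 : forall r : nat, (1 <= r <= k)%N -> 0 < b1 r + b2 r)
    (c_gt0 : forall r : nat, (1 <= r <= k)%N -> 0 < c1 r + c2 r)
    (theta_id : forall q : R[i], q != 0 -> `|q| < 1 ->
       theta (q ^ i) (q ^ j) * theta (q ^ s) (q ^ t) * theta (q ^ u) (q ^ v) =
       \sum_(1 <= r < k.+1)
          (m r)%:R * q ^+ (r - 1)
          * theta (q ^ (k%:Z * a1 r)) (q ^ (k%:Z * a2 r))
          * theta (q ^ (k%:Z * b1 r)) (q ^ (k%:Z * b2 r))
          * theta (q ^ (k%:Z * c1 r)) (q ^ (k%:Z * c2 r))) (e : int) :
  sum3_theta_exp i j s t u v e <->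
  exists2 r : nat, (1 <= r <= k)%N &
    exists2 n : int,
      sum3_theta_exp (a1 r) (a2 r) (b1 r) (b2 r) (c1 r) (c2 r) n &
      e = (r - 1)%N%:Z + k%:Z * n.
Proof.
have scale_gt0 (x y : int) : 0 < x + y -> 0 < k%:Z * x + k%:Z * y.
  by rewrite -mulrDr => xy_gt0; rewrite mulr_gt0.
have in_range r : (r \in index_iota 1 k.+1) = (1 <= r <= k)%N.
  by rewrite mem_index_iota ltnS.
(* The exponents of the monomial [m_r x^(r-1)]: [m r] copies of [r - 1], at least one because [m r]
   is positive. *)
pose w r := mul_exps (fun=> nseq (m r) 0) (fun=> [:: (r - 1)%N%:Z]).
have wF r := enumerates_mul (enumerates_nseq R (m r)) (enumerates_cst R (r - 1)%N%:Z).
have w_supp r d : (1 <= r <= k)%N -> support (w r) d <-> d = (r - 1)%N%:Z.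
  move=> r_in; split=> [[_ /allpairsP[[a b] /= []]] | ->].
    by rewrite mem_nseq inE => /andP[_ /eqP ->] /eqP -> ->; rewrite add0r.
  exists 0%N; apply/allpairsP; exists (0, (r - 1)%N%:Z) => /=.
  by rewrite mem_nseq inE m_gt0 ?eqxx ?add0r.
pose rhs r := mul_exps (mul_exps (mul_exps (w r)
    (theta_exps (k%:Z * a1 r) (k%:Z * a2 r)))
    (theta_exps (k%:Z * b1 r) (k%:Z * b2 r)))
    (theta_exps (k%:Z * c1 r) (k%:Z * c2 r)).
pose rhs_sum r (x : R) := (m r)%:R * x ^ (r - 1)%N%:Z
    * real_theta (k%:Z * a1 r) (k%:Z * a2 r) x
    * real_theta (k%:Z * b1 r) (k%:Z * b2 r) x
    * real_theta (k%:Z * c1 r) (k%:Z * c2 r) x.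
have rhsF r : r \in index_iota 1 k.+1 -> enumerates (rhs r) (rhs_sum r).
  rewrite in_range => r_in.
  exact: (enumerates_theta_product (wF r) (scale_gt0 _ _ (a_gt0 _ r_in))
            (scale_gt0 _ _ (b_gt0 _ r_in)) (scale_gt0 _ _ (c_gt0 _ r_in))).
(* The leading factor [x ^ 0 = 1] gives the left side the shape of a summand on the right. *)
pose lhs := mul_exps (mul_exps (mul_exps (fun=> [:: 0]) (theta_exps i j))
    (theta_exps s t)) (theta_exps u v).
have lhsF := enumerates_theta_product (enumerates_cst R 0) ij_gt0 st_gt0 uv_gt0.
have {}rhsF := enumerates_sum rhsF.
have supp_eq : forall e, support lhs e <->
    support (fun N => flatten [seq rhs r N | r <- index_iota 1 k.+1]) e.
  (* It remains to see that both sides enumerate the same real function: this is [theta_id] at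
     [q = x], read back through the injection of [R] into [R[i]]. *)
  apply: enumerates_unique rhsF; apply: enumerates_eq lhsF => x x01.
  have x_gt0 : 0 < x by case/andP: x01.
  apply: (@complexI R); rewrite expr0z mul1r !rmorphM /=.
  rewrite -!theta_real_complex // theta_id.
  - rewrite rmorph_sum big_seq [RHS]big_seq; apply: eq_bigr => r.
    rewrite in_range => r_in /=; rewrite !rmorphM /= -!theta_real_complex; auto.
    by rewrite rmorph_nat rmorphXn.
  - by rewrite (inj_eq (@complexI R) x 0) gt_eqF.
  - by rewrite normc_def /= expr0n addr0 sqrtr_sqr gtr0_norm // ltcR; case/andP: x01.
have lhs_supp : sum3_theta_exp i j s t u v e <-> support lhs e.
  rewrite (support_theta_product _ (enumerates_cst R 0) ij_gt0 st_gt0 uv_gt0).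
  split=> [e_rep | [d [_ +] [n n_rep ->]]].
    by exists 0; [exists 0%N; rewrite inE | exists e; rewrite ?add0r].
  by rewrite inE => /eqP ->; rewrite add0r.
rewrite lhs_supp supp_eq support_sum; split.
  move=> [r]; rewrite in_range => r_in.
  move=> /(support_theta_product _ (wF r)) [||| d /w_supp -> // [n]];
    try by apply: scale_gt0; auto.
  move=> [x [y [z ->]]] ->; exists r => //.
  exists (theta_exp (a1 r) (a2 r) x + theta_exp (b1 r) (b2 r) y
          + theta_exp (c1 r) (c2 r) z); first by exists x, y, z.
  by rewrite !theta_exp_scale !mulrDr.
move=> [r r_in [n [x [y [z ->]]] ->]]; exists r; first by rewrite in_range.
apply/(support_theta_product _ (wF r)); try by apply: scale_gt0; auto.
exists (r - 1)%N%:Z; first exact/w_supp.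
eexists; last by [].
by exists x, y, z; rewrite !theta_exp_scale !mulrDr.
Qed.

(** Uniqueness of Euclidean division: the offsets [r - 1] and [r' - 1] lie in [[0, k)], too small to
    compensate for a difference of [k] or more. *)
Lemma residue_inj (k r r' : nat) (n n' : int) :
  (1 <= r <= k)%N -> (1 <= r' <= k)%N ->
  (r - 1)%N%:Z + k%:Z * n = (r' - 1)%N%:Z + k%:Z * n' -> n = n' /\ r = r'.
Proof.
move=> r_in r'_in E; have En : n = n'.
  have [lt_n | gt_n | //] := ltgtP n n'.
    have : k%:Z * (n + 1) <= k%:Z * n' by rewrite ler_wpM2l //; lia.
    by rewrite mulrDr mulr1; lia.
  have : k%:Z * (n' + 1) <= k%:Z * n by rewrite ler_wpM2l //; lia.
  by rewrite mulrDr mulr1; lia.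
by split=> //; move: E; rewrite En => /addIr; lia.
Qed.

Theorem theorem1p1 (R : realType) (i j s t u v : int)
    (k : nat) (m : nat -> nat) (a1 a2 b1 b2 c1 c2 : nat -> int)
    (ij_gt0 : 0 < i + j) (st_gt0 : 0 < s + t) (uv_gt0 : 0 < u + v)
    (k_gt0 : (0 < k)%N)
    (m_gt0 : forall r : nat, (1 <= r <= k)%N -> (0 < m r)%N)
    (a_gt0 : forall r : nat, (1 <= r <= k)%N -> 0 < a1 r + a2 r)
    (b_gt0 : forall r : nat, (1 <= r <= k)%N -> 0 < b1 r + b2 r)
    (c_gt0 : forall r : nat, (1 <= r <= k)%N -> 0 < c1 r + c2 r)
    (theta_id : forall q : R[i], q != 0 -> `|q| < 1 ->
       theta (q ^ i) (q ^ j) * theta (q ^ s) (q ^ t) * theta (q ^ u) (q ^ v) =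
       \sum_(1 <= r < k.+1)
          (m r)%:R * q ^+ (r - 1)
          * theta (q ^ (k%:Z * a1 r)) (q ^ (k%:Z * a2 r))
          * theta (q ^ (k%:Z * b1 r)) (q ^ (k%:Z * b2 r))
          * theta (q ^ (k%:Z * c1 r)) (q ^ (k%:Z * c2 r))) :
  (universal (i + j) (i - j) (s + t) (s - t) (u + v) (u - v) <->
   forall r : nat, (1 <= r <= k)%N ->
     universal (a1 r + a2 r) (a1 r - a2 r) (b1 r + b2 r) (b1 r - b2 r)
               (c1 r + c2 r) (c1 r - c2 r))
  /\
  (almost_universal (i + j) (i - j) (s + t) (s - t) (u + v) (u - v) <->
   forall r : nat, (1 <= r <= k)%N ->
     almost_universal (a1 r + a2 r) (a1 r - a2 r) (b1 r + b2 r) (b1 r - b2 r)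
                      (c1 r + c2 r) (c1 r - c2 r)).
Proof.
have eq_rep := theta_identity_support ij_gt0 st_gt0 uv_gt0 k_gt0 m_gt0
  a_gt0 b_gt0 c_gt0 theta_id.
pose rep0 := represented (i + j) (i - j) (s + t) (s - t) (u + v) (u - v).
pose rep r := represented (a1 r + a2 r) (a1 r - a2 r) (b1 r + b2 r) (b1 r - b2 r)
                (c1 r + c2 r) (c1 r - c2 r).
have repE r (n : nat) : (1 <= r <= k)%N -> rep0 (r - 1 + k * n)%N <-> rep r n.
  move=> r_in; rewrite /rep0 /rep !representedE eq_rep; split; last first.
    by move=> n_rep; exists r => //; exists n%:Z => //; rewrite PoszD PoszM.
  move=> [r' r'_in [n' n'_rep E]].
  rewrite PoszD PoszM in E.
  by have [-> ->] := residue_inj r_in r'_in E.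
have residue (n : nat) : exists2 r, (1 <= r <= k)%N & n = (r - 1 + k * (n %/ k))%N.
  (* The successor appears because [r] is counted from 1 while residues start at 0. *)
  exists (n %% k).+1; first by rewrite ltn_pmod.
  by rewrite subn1 /= addnC mulnC -divn_eq.
split; split.
- by move=> univ r r_in n; apply/repE => //; apply: univ.
- by move=> univ n; have [r r_in ->] := residue n; apply/repE => //; apply: univ.
(* The exceptions of the [r]-th form are sent injectively by [n -> r - 1 + k n] to exceptions of the
   left-hand form. *)
- move=> fin r r_in.
  apply: sub_finite_set (finite_preimage (f := fun n => (r - 1 + k * n)%N) _ fin).
    by move=> n /= + /(repE _ _ r_in).
  by move=> n n' _ _ /addnI /eqP; rewrite eqn_pmul2l // => /eqP.
(* Conversely, every exception on the left lies in one of [k] images of finite exception sets,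
   according to its residue. *)
- move=> fin; apply: sub_finite_set (bigcup_finite
      (D := [set r | (1 <= r <= k)%N]%classic)
      (F := fun r => ((fun n => (r - 1 + k * n)%N) @` [set n | ~ rep r n])%classic) _ _).
  + move=> n /= n_rep; have [r r_in En] := residue n; exists r => //=.
    by exists (n %/ k)%N; [move: n_rep; rewrite {1}En => + /(repE _ _ r_in) | ].
  + by apply: sub_finite_set (finite_II k.+1) => r /= /andP[_]; rewrite ltnS.
  + by move=> r r_in; apply: finite_image; apply: fin.
Qed.
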